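(* Let $d$ be a positive integer. A tree $T$ on $n\geq 5$ vertices is $\alpha_d$-extremal if and only if $T$ is obtained from a $(d+1)$-regular tree by subdividing every leaf-edge once.
   Context: For a graph $G$, $\alpha_d(G)$ denotes the maximum cardinality of an independent set of $G$ all of whose vertices have degree at most $d$ in $G$. A tree $T$ on $n$ vertices is called $\alpha_d$-extremal if $\alpha_d(T)=\frac{(d-1)n+2}{2d-1}$. For a positive integer $m$, a tree is called $m$-regular if every vertex has degree $1$ or $m$, and there is at least one vertex of degree $m$. A leaf is a vertex of degree $1$, and a leaf-edge is an edge incident to a leaf. Subdividing an edge $vw$ once means replacing it by a path $v,x,w$ where $x$ is a new vertex. *)

(* Defs.v *)
From HB Require Import structures.
From mathcomp Require Import all_boot all_order all_algebra.

Set Implicit Arguments.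
Unset Strict Implicit.
Unset Printing Implicit Defensive.

Record sgraph := SGraph {
  vertex :> finType;
  adj : rel vertex;
  adj_sym : symmetric adj;
  adj_irrefl : irreflexive adj }.

Section Graph.
Variable G : sgraph.

Definition neighbours (x : G) : {set G} := [set y | adj x y].

Definition deg (x : G) : nat := #|neighbours x|.

Definition leaf (x : G) : bool := deg x == 1.

Definition independent (S : {set G}) : bool :=
  [forall x in S, forall y in S, ~~ adj x y].

Definition alpha (d : nat) : nat :=
  \max_(S : {set G} | independent S && [forall x in S, deg x <= d]) #|S|.

Definition connected : Prop :=
  0 < #|G| /\ forall x y : G, connect (@adj G) x y.

(* [:: x; y] is a [ucycle] of [adj] whenever x and y are adjacent, hence the
   bound 2; sequences of length at least 3 are the genuine graph cycles. *)
Definition acyclic : Prop :=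
  forall c : seq G, ucycle (@adj G) c -> size c <= 2.

Definition tree : Prop := connected /\ acyclic.

Definition regular_tree (m : nat) : Prop :=
  [/\ tree, forall x : G, deg x = 1 \/ deg x = m & exists x : G, deg x = m].

Definition edges : {set {set G}} :=
  [set E : {set G} | [exists x, exists y, adj x y && (E == [set x; y])]].

Definition leaf_edges : {set {set G}} :=
  [set E in edges | [exists x in E, leaf x]].

End Graph.

(* The quotient is taken in rat, so that neither the subtraction nor the
   division is truncated. *)
Definition alpha_extremal (d : nat) (G : sgraph) : Prop :=
  ((alpha G d)%:R = ((d%:R - 1) * #|G|%:R + 2) / (2 * d%:R - 1) :> rat)%R.

Section Subdivision.
Variables (G : sgraph) (F : {set {set G}}).

(* The new vertex subdividing an edge E of F is [inr E]; its neighbours are the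
   two ends of E. *)
Definition subdivision_adj (u v : G + {E : {set G} | E \in F}) : bool :=
  match u, v with
  | inl x, inl y => adj x y && ([set x; y] \notin F)
  | inl x, inr E => x \in val E
  | inr E, inl y => y \in val E
  | inr _, inr _ => false
  end.

Lemma subdivision_adj_sym : symmetric subdivision_adj.
Proof. by move=> [x|E] [y|E'] //=; rewrite adj_sym setUC. Qed.

Lemma subdivision_adj_irrefl : irreflexive subdivision_adj.
Proof. by move=> [x|E] //=; rewrite adj_irrefl. Qed.

(* Meaningful for F \subset edges G. *)
Definition subdivision : sgraph :=
  SGraph subdivision_adj_sym subdivision_adj_irrefl.

End Subdivision.

Definition isomorphic (G H : sgraph) : Prop :=
  exists f : G -> H, bijective f /\ forall x y, adj (f x) (f y) = adj x y.

(* Main.v *)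
Require Import Defs.
From mathcomp Require Import all_boot all_order all_algebra.
From mathcomp Require Import zify ring.

(* Let L be the vertices of degree at most d and suppose that some vertex r has
   degree greater than d. Root T at r and let I be the set of vertices of L whose
   parent is not in L. I is independent, and counting the children of the h
   vertices outside L gives |I| >= (d-1)h + 2; as T is bipartite, also
   2 alpha_d >= |L|. With h + |L| = n these add up to
   (2d-1) alpha_d >= (d-1)n + 2. In the equality case the vertices outside L form
   a subtree, all have degree d+1, and I is a maximum set; replacing a few
   vertices of I shows that every component of T[L] is a single edge (d > 1)
   hanging from that subtree, so that deleting the leaves of T leaves a
   (d+1)-regular tree of which T is the subdivision.
   Conversely, in such a subdivision an independent set of vertices of degree at
   most d meets each pendant edge at most once and contains nothing else, and a
   degree count evaluates the number of pendant edges. *)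

Set Implicit Arguments.
Unset Strict Implicit.
Unset Printing Implicit Defensive.

(** * Rooted trees, degree counts and the bipartition *)

Section Rooting.
Variable G : sgraph.

Definition del_edge (u v : G) : rel G :=
  fun x y => adj x y && ([set x; y] != [set u; v]).

Lemma del_edge_sym u v : symmetric (del_edge u v).
Proof. by move=> x y; rewrite /del_edge adj_sym setUC. Qed.

(** A simple path from u to v avoiding the edge uv would close up with it to a genuine cycle. *)
Lemma acyclic_bridge (u v : G) :
  acyclic G -> adj u v -> ~~ connect (del_edge u v) u v.
Proof.
move=> acG uv; apply/negP => /connectP [q0 q0P vE].
move: vE uv; case/shortenP: q0P => q qP quniq _ vE uv.
have : ucycle (@adj G) (u :: q).
  rewrite /ucycle quniq andbT /= rcons_path -vE adj_sym uv andbT.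
  by apply: sub_path qP => x y /andP[].
(* The bound 2 on cycles leaves an empty path, where u = v, and a single step, which is the deleted
   edge itself. *)
move/acG; case: q qP vE {quniq} => [|a [|b q]] //=.
  by move=> _ vu; rewrite vu adj_irrefl in uv.
by rewrite andbT => + va; rewrite /del_edge va eqxx andbF.
Qed.

(** [p] is the parent map and [dep] the depth. Nothing is prescribed for [p r], hence the guards
    [x != r]. *)
Definition rooting (r : G) (p : G -> G) (dep : G -> nat) : Prop :=
  [/\ forall x, x != r -> dep x = (dep (p x)).+1 &
      forall x y, adj x y = (x != r) && (y == p x) || (y != r) && (x == p y)].

(** Depth is the distance from [r], and the parent is any neighbour one step closer. An edge that is
    not a parent edge would fail to be a bridge. *)
Lemma tree_rooting (r : G) : tree G -> exists p dep, rooting r p dep.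
Proof.
move=> [[_ conn] acG].
pose reach x n := [exists q : n.-tuple G, path (@adj G) r q && (last r q == x)].
have reachP x n : reflect (exists q, [/\ path (@adj G) r q, last r q = x & size q = n])
    (reach x n).
  apply: (iffP existsP) => [[q /andP[qP /eqP qx]]|[q [qP qx /eqP qn]]].
    by exists q; rewrite size_tuple.
  by exists (Tuple qn); rewrite /= qP qx eqxx.
have ex_reach x : exists n, reach x n.
  by have /connectP[q qP ->] := conn r x; exists (size q); apply/reachP; exists q.
pose dep x := ex_minn (ex_reach x).
have par_ex x : x != r -> exists y, adj x y && (dep x == (dep y).+1).
  rewrite /dep; case: ex_minnP => n /reachP[q [qP qx <-]] nmin xr.
  case/lastP: q qP qx nmin => [_ /= rx|q z]; first by rewrite rx eqxx in xr.
  rewrite rcons_path last_rcons size_rcons => /andP[qP lz] zx nmin.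
  rewrite zx in lz; exists (last r q); rewrite adj_sym lz /=.
  case: ex_minnP => m /reachP[q' [q'P q'y <-]] mmin.
  rewrite eqSS eqn_leq mmin ?andbT; last by apply/reachP; exists q.
  rewrite -ltnS -[(size q').+1](size_rcons _ x) nmin //.
  by apply/reachP; exists (rcons q' x); rewrite rcons_path q'P q'y lz last_rcons.
pose p x := odflt r [pick y | adj x y && (dep x == (dep y).+1)].
have pP x : x != r -> adj x (p x) /\ dep x = (dep (p x)).+1.
  move=> /par_ex[y yP]; rewrite /p; case: pickP => [z /andP[? /eqP]|/(_ y)] //.
  by rewrite yP.
exists p, dep; split=> [x /pP[]//|x y].
apply/idP/idP => [xy|/orP[|]/andP[xr /eqP->]]; last 2 first.
- by case: (pP _ xr).
- by rewrite adj_sym; case: (pP _ xr).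
apply: contraT; rewrite negb_or => /andP[nxy nyx].
(* Every vertex climbs to [r] along parent edges, none of which is xy; so x and y stay connected
   without that edge. *)
have to_root z : connect (del_edge x y) z r.
  have [n] := ubnP (dep z); elim: n z => // n IHn z zn.
  have [->|zr] := eqVneq z r; first exact: connect0.
  have [zp zd] := pP _ zr.
  apply: connect_trans (IHn (p z) _); last by rewrite -ltnS -zd.
  apply: connect1; rewrite /del_edge zp /=.
  apply: contra nxy => /eqP E.
  have zE : z \in [set x; y] by rewrite -E set21.
  have pE : p z \in [set x; y] by rewrite -E set22.
  have zpz : z != p z by apply: contraL zp => /eqP<-; rewrite adj_irrefl.
  move: zE pE zpz zr; rewrite !inE => /orP[/eqP->|/eqP zy].
    by case/orP=> /eqP-> //; rewrite eqxx ?andbT.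
  subst z => /orP[/eqP pE|/eqP->]; last by rewrite eqxx.
  by move=> _ yr; move: nyx; rewrite yr pE eqxx.
have /negP[] := acyclic_bridge acG xy.
apply: connect_trans (to_root x) _.
by rewrite (sym_connect_sym (@del_edge_sym x y)) to_root.
Qed.

Section RootedCounting.
Variables (r : G) (p : G -> G) (dep : G -> nat).
Hypothesis rt : rooting r p dep.

Definition children (x : G) : {set G} := [set w | (w != r) & (p w == x)].

Lemma rooting_par x : x != r -> adj x (p x).
Proof. by case: rt => _ adjE xr; rewrite adjE xr eqxx. Qed.

Lemma rooting_neighbours x :
  neighbours x = (if x != r then [set p x] else set0) :|: children x.
Proof.
case: rt => _ adjE; apply/setP => y; rewrite !inE adjE [p y == x]eq_sym.
by case: (x != r); rewrite !inE.
Qed.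

Lemma par_notin_children x : x != r -> p x \notin children x.
Proof.
case: rt => depS _ xr; rewrite inE; apply/negP => /andP[pr /eqP ppx].
by have := depS _ xr; rewrite (depS _ pr) ppx; lia.
Qed.

Lemma deg_rooting x : deg x = #|children x| + (x != r).
Proof.
rewrite /deg rooting_neighbours; case: ifP => [xr|_].
  by rewrite cardsU1 par_notin_children // addnC.
by rewrite set0U addn0.
Qed.

Lemma sum_children (A : {set G}) :
  \sum_(x in A) #|children x| = #|[set v | (v != r) & (p v \in A)]|.
Proof.
rewrite -sum1_card [RHS](partition_big p [in A]) => [|v]; last by rewrite inE => /andP[].
apply: eq_bigr => x xA; rewrite -sum1_card; apply: eq_bigl => v.
by rewrite !inE -andbA; case: (p v =P x) => [->|_]; rewrite ?xA ?andbF.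
Qed.

(** Each vertex of A contributes its children and its parent edge; the root alone has no parent,
    which accounts for the successor. *)
Lemma sum_deg_rooting (A : {set G}) : r \in A ->
  (\sum_(x in A) deg x).+1 = #|[set v | (v != r) & (p v \in A)]| + #|A|.
Proof.
move=> rA; under eq_bigr do rewrite deg_rooting.
rewrite big_split /= sum_children -addnS (bigD1 r) //= eqxx add0n.
rewrite (cardsD1 r A) rA add1n; congr (_ + _.+1).
rewrite -sum1_card; apply: eq_big => [x|x /andP[_ ->] //].
by rewrite !inE andbC.
Qed.

Lemma odd_dep x y : adj x y -> odd (dep x) != odd (dep y).
Proof.
case: rt => depS adjE; rewrite adjE.
by case/orP => /andP[xr /eqP->]; rewrite (depS _ xr) /=; case: odd.
Qed.

End RootedCounting.

(** Handshake for n - 1 edges, free of subtraction: the previous count applied to all vertices. *)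
Lemma sum_deg_tree : tree G -> (\sum_(x : G) deg x) + 2 = 2 * #|G|.
Proof.
move=> tG; have [[G0 _] _] := tG.
have [r _] : exists r : G, true by case/card_gt0P: G0 => r; exists r.
have [p [dep rt]] := tree_rooting r tG.
have := sum_deg_rooting rt (in_setT r).
rewrite cardsT (eq_bigl predT) => [|x]; last by rewrite inE.
suff -> : [set v | v != r & p v \in [set: G]] = [set~ r].
  by rewrite cardsC1; move: (\sum_(_ | _) _) => s; lia.
by apply/setP => v; rewrite !inE andbT.
Qed.

Lemma connected_closed (A : {set G}) (a : G) : connected G -> a \in A ->
  (forall x y, x \in A -> adj x y -> y \in A) -> forall x, x \in A.
Proof.
move=> [_ conn] aA clA x; have clA' : closed (@adj G) A.
  by apply: intro_closed => [|u v uv uA]; [apply: sym_connect_sym; apply: adj_sym|apply: clA uv].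
by rewrite -(closed_connect clA' (conn a x)).
Qed.

Lemma connected_card_le (A : {set G}) (a : G) : connected G -> a \in A ->
  (forall x y, x \in A -> adj x y -> y \in A) -> #|G| <= #|A|.
Proof.
move=> cG aA clA; apply/subset_leq_card/subsetP=> x _.
exact: (connected_closed cG aA clA).
Qed.

Lemma independentP (S : {set G}) :
  reflect {in S &, forall x y, ~~ adj x y} (independent S).
Proof.
apply: (iffP forall_inP) => [h x y xS yS|h x xS]; last by apply/forall_inP => y; apply: h.
by have /forall_inP := h x xS; apply.
Qed.

Lemma leq_alpha d (S : {set G}) :
  {in S &, forall x y, ~~ adj x y} -> {in S, forall x, deg x <= d} ->
  #|S| <= alpha G d.
Proof.
move=> /independentP Si Sd; apply: (@leq_bigmax_cond _ _ (fun S : {set G} => #|S|)).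
by rewrite Si /=; apply/forall_inP.
Qed.

Lemma alpha_leq d m :
  (forall S : {set G}, {in S &, forall x y, ~~ adj x y} ->
     {in S, forall x, deg x <= d} -> #|S| <= m) ->
  alpha G d <= m.
Proof.
move=> h; apply/bigmax_leqP => S /andP[/independentP Si /forall_inP Sd].
exact: h.
Qed.

Definition leaf_neighbours (x : G) : {set G} := [set y in neighbours x | leaf y].

End Rooting.

Lemma leaf_neighbour_unique (G : sgraph) (x y z : G) :
  y \in leaf_neighbours x -> adj y z -> z = x.
Proof.
rewrite !inE => /andP[xy /cards1P[w Ny]] yz.
have : x \in neighbours y by rewrite inE adj_sym.
have : z \in neighbours y by rewrite inE.
by rewrite Ny => /set1P-> /set1P->.
Qed.

Lemma leaf_unique_neighbour (G : sgraph) (x y z : G) :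
  leaf x -> adj x y -> adj x z -> y = z.
Proof.
move=> /cards1P[w Nx] xy xz.
have : y \in neighbours x by rewrite inE.
have : z \in neighbours x by rewrite inE.
by rewrite Nx => /set1P-> /set1P->.
Qed.

(** With d = e + 1 the quantities d - 1 and 2d - 1 become the naturals e and 2e + 1, so clearing the
    denominator stays inside [nat]. *)
Lemma alpha_extremal_nat e (G : sgraph) :
  alpha_extremal e.+1 G <-> (2 * e).+1 * alpha G e.+1 = e * #|G| + 2.
Proof.
rewrite /alpha_extremal; move: (alpha _ _) #|_| => a n.
have -> : (e.+1%:R - 1 = e%:R :> rat)%R by rewrite GRing.mulrSr GRing.addrK.
have -> : (2 * e.+1%:R - 1 = (2 * e).+1%:R :> rat)%R.
  by rewrite -GRing.natrM mulnS GRing.natrD -[in RHS]addn1 GRing.natrD; ring.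
split=> [H|H].
  apply/eqP; rewrite -(Num.Theory.eqr_nat rat) GRing.natrM H GRing.mulrC.
  by rewrite GRing.divfK ?Num.Theory.pnatr_eq0 // GRing.natrD GRing.natrM.
apply: (canRL (GRing.mulfK _)); first by rewrite Num.Theory.pnatr_eq0.
by rewrite -GRing.natrM mulnC H GRing.natrD GRing.natrM.
Qed.

(* Together with n >= 5 this characterises, for trees, the subdivided (d+1)-regular
   trees; P4 satisfies it as well. *)
Definition bristled d (G : sgraph) : Prop :=
  (forall x : G, leaf_neighbours x != set0 -> deg x = 2 /\ #|leaf_neighbours x| = 1) /\
  (forall x : G, ~~ leaf x -> leaf_neighbours x = set0 -> deg x = d.+1).

(** * Low-degree vertices of an extremal tree *)

Section Extremal.
Variables (G : sgraph) (r : G) (p : G -> G) (dep : G -> nat) (d : nat).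
Hypothesis rt : rooting r p dep.

(** [low] and [top] are the sets L and I of the overview. Once the root lies outside [low], [top]
    collects the topmost vertices of the components of T[L]. *)
Definition low : {set G} := [set x | deg x <= d].
Definition top : {set G} := [set v in low | p v \notin low].

(** The parity of the depth splits [low] into two independent sets. *)
Lemma card_low_leq : #|low| <= 2 * alpha G d.
Proof.
have half b : #|low :&: [set x | odd (dep x) == b]| <= alpha G d.
  apply: leq_alpha => [x y|x]; last by rewrite !inE => /andP[].
  rewrite !inE => /andP[_ /eqP xb] /andP[_ /eqP yb]; apply/negP => /(odd_dep rt).
  by rewrite xb yb eqxx.
rewrite -(cardsID [set x | odd (dep x) == true]) mul2n -addnn leq_add ?half //.
rewrite (_ : low :\: _ = low :&: [set x | odd (dep x) == false]) ?half //.
by apply/setP => x; rewrite !inE andbC eqbF_neg eqb_id.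
Qed.

Hypothesis rhigh : r \notin low.

Lemma low_root x : x \in low -> x != r.
Proof. by apply: contraL => /eqP->. Qed.

Lemma low_adj x y : x \in low -> y \in low -> adj x y = (y == p x) || (x == p y).
Proof. by case: rt => _ adjE xL yL; rewrite adjE !low_root. Qed.

Lemma top_indep : {in top &, forall x y, ~~ adj x y}.
Proof.
move=> x y; rewrite !inE => /andP[xL px] /andP[yL py].
rewrite low_adj ?inE //; apply/norP; split.
  by apply: contraNneq px => <-.
by apply: contraNneq py => <-.
Qed.

Lemma top_low x : x \in top -> x \in low. Proof. by rewrite inE => /andP[]. Qed.

(** Stands for the edges with both ends outside [low], each represented by its end further from the
    root. *)
Definition high_links : {set G} := [set v in ~: low | (v != r) & (p v \notin low)].

(** The children of the vertices outside [low] are of two kinds: the low ones form [top], the others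
    [high_links]. *)
Lemma card_top_eq :
  #|top| + #|high_links| + #|~: low| = (\sum_(x in ~: low) deg x).+1.
Proof.
rewrite (sum_deg_rooting rt) ?in_setC //.
congr (_ + _); rewrite -[RHS](cardsID low); congr (_ + _); apply: eq_card => v.
  rewrite !inE; have [vL|//] := boolP (deg v <= d); last by rewrite andbF.
  by rewrite (low_root (x := v)) ?inE // andbT.
by rewrite !inE.
Qed.

Lemma card_high_links : #|high_links| < #|~: low|.
Proof.
apply: proper_card; apply/properP; split; first by apply/subsetP => x; rewrite inE => /andP[].
by exists r; rewrite ?in_setC // inE eqxx andbF.
Qed.

Lemma sum_deg_high : d.+1 * #|~: low| <= \sum_(x in ~: low) deg x.
Proof.
rewrite mulnC -sum_nat_const; apply: leq_sum => x.
by rewrite !inE -ltnNge.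
Qed.

Lemma top_alpha : #|top| <= alpha G d.
Proof. by apply: leq_alpha top_indep _ => x /top_low; rewrite inE. Qed.

Hypothesis d_gt0 : 0 < d.
Hypothesis alphaE : alpha G d = d.-1 * #|~: low| + 2.

(** With h vertices outside [low], the count gives |[top]| >= (d+1)h + 1 - (h-1) - h = (d-1)h + 2,
    which is alpha by [alphaE]. Since |[top]| <= alpha, all the inequalities used are equalities. *)
Lemma top_extremal :
  [/\ #|top| = alpha G d, \sum_(x in ~: low) deg x = d.+1 * #|~: low|
    & #|high_links|.+1 = #|~: low|].
Proof.
have := card_top_eq; have := card_high_links; have := sum_deg_high; have := top_alpha.
move: d_gt0 alphaE (\sum_(_ in _) _) => d0 aE s.
have -> : d.+1 * #|~: low| = d.-1 * #|~: low| + 2 * #|~: low|.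
  by rewrite -mulnDl; congr (_ * _); lia.
by move: (d.-1 * _) aE => q aE *; split; lia.
Qed.

Lemma deg_high x : x \notin low -> deg x = d.+1.
Proof.
move=> xH; have [_ sumE _] := top_extremal.
have le_deg y : y \in ~: low -> d.+1 <= deg y ?= iff (deg y == d.+1).
  by rewrite !inE -ltnNge => yH; split; rewrite // eq_sym.
have [_] := leqif_sum le_deg.
rewrite sum_nat_const sumE mulnC eqxx => /esym/forall_inP/(_ x).
by rewrite inE => /(_ xH)/eqP.
Qed.

(** There are h - 1 links among the h high vertices, so every high vertex but the root is a link:
    the high vertices form a subtree. *)
Lemma par_high x : x \notin low -> x != r -> p x \notin low.
Proof.
move=> xH xr; have [_ _ cE] := top_extremal.
have sub : high_links \subset ~: low :\ r.
  by apply/subsetP => v; rewrite !inE => /and3P[-> ->].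
have : high_links = ~: low :\ r.
  apply/eqP; rewrite eqEcard sub /=.
  by rewrite -ltnS cE (cardsD1 r (~: low)) inE rhigh.
by move/setP/(_ x); rewrite !in_setD1 in_setC xH xr /= inE => /and3P[].
Qed.

(** Exchange argument: [top] is a maximum set, so trading A for a larger B must destroy
    independence. *)
Lemma no_extension (A B : {set G}) : A \subset top -> #|A| < #|B| ->
  [disjoint B & top :\: A] ->
  B \subset low -> {in B &, forall x y, ~~ adj x y} ->
  ~ {in B & top :\: A, forall x y, ~~ adj x y}.
Proof.
move=> AT AB dis BL Bi cross; have [cE _ _] := top_extremal.
suff : #|B :|: top :\: A| <= alpha G d.
  rewrite leqNgt => /negP[]; rewrite -cE cardsU.
  have /eqP-> : B :&: (top :\: A) == set0 by rewrite setI_eq0.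
  rewrite cards0 subn0 cardsD (setIidPr AT).
  by have := subset_leq_card AT; move: #|A| #|B| #|top| AB => *; lia.
apply: leq_alpha => [x y|x].
  case/setUP=> xP /setUP[] yP.
  - exact: Bi.
  - exact: cross.
  - by rewrite adj_sym; apply: cross.
  - by case/setDP: xP => xP _; case/setDP: yP => yP _; apply: top_indep.
case/setUP => [/(subsetP BL)|/setDP[/top_low]]; by rewrite inE.
Qed.

(** Otherwise [v] could be added to [top]: its parent is not in [top], and neither is any child of
    [v], whose parent [v] is low. Thus components of T[L] have at most two levels. *)
Lemma par_low_top v : v \in low -> p v \in low -> p v \in top.
Proof.
move=> vL pL; apply: contraT => pT.
have ppL : p (p v) \in low by move: pT; rewrite inE pL /= negbK.
have vT : v \notin top by rewrite inE vL pL.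
case: (@no_extension set0 [set v]); rewrite ?sub0set ?cards0 ?cards1 //.
- by rewrite setD0 disjoints1.
- by rewrite sub1set.
- by move=> x y; rewrite !inE => /eqP-> /eqP->; rewrite adj_irrefl.
move=> x y; rewrite setD0 inE => /eqP-> yT; rewrite low_adj ?(top_low yT) //.
apply/norP; split; first by apply: contraNneq pT => <-.
by apply: contraTneq yT => vE; rewrite inE -vE vL andbF.
Qed.

Lemma child_low_low v w : v \in low -> w \in children r p v -> w \in low.
Proof.
rewrite [w \in children _ _ _]inE => vL /andP[wr /eqP pw]; apply: contraT => wH.
by have := par_high wH wr; rewrite pw vL.
Qed.

Lemma deg_low_nontop v : v \in low -> v \notin top -> deg v = 1.
Proof.
move=> vL vT; rewrite (deg_rooting rt) low_root //.
suff -> : children r p v = set0 by rewrite cards0.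
apply/setP => w; rewrite [RHS]inE; apply/negP => wc.
have wL := child_low_low vL wc; move: wc; rewrite inE => /andP[_ /eqP pw].
by have := par_low_top wL; rewrite pw => /(_ vL); rewrite (negbTE vT).
Qed.

Lemma child_nontop v w : v \in low -> w \in children r p v -> w \in low :\: top.
Proof.
move=> vL wc; rewrite inE (child_low_low vL wc) andbT.
by move: wc; rewrite !inE => /andP[_ /eqP->]; rewrite inE in vL; rewrite vL andbF.
Qed.

(** Two such siblings could replace their common parent in [top], giving a larger set. *)
Lemma par_inj : {in low :\: top &, injective p}.
Proof.
move=> a b; rewrite !in_setD => /andP[aT aL] /andP[bT bL] pab.
have [//|ab] := eqVneq a b.
have pL c : c \in low -> c \notin top -> p c \in low.
  by move=> cL; apply: contraR => pc; rewrite inE cL.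
have vT := par_low_top aL (pL _ aL aT).
case: (@no_extension [set p a] [set a; b]).
- by rewrite sub1set.
- by rewrite cards1 cards2 ab.
- rewrite disjoints_subset; apply/subsetP => x.
  by rewrite in_set2 in_setC in_setD => /orP[] /eqP->; rewrite ?(negbTE aT) ?(negbTE bT) andbF.
- by apply/subsetP => x; rewrite in_set2 => /orP[] /eqP->.
- have nab : ~~ adj a b.
    rewrite low_adj //; apply/norP; split.
      by apply: contraTneq vT => <-.
    by rewrite -pab; apply: contraTneq vT => <-.
  by move=> x y; rewrite !inE => /orP[] /eqP-> /orP[] /eqP->; rewrite ?adj_irrefl // adj_sym.
have key c y : c \in low -> c \notin top -> y \in top -> y != p c -> ~~ adj c y.
  move=> cL cT yT yc; rewrite low_adj ?(top_low yT) // (negbTE yc) /=.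
  by apply: contraTneq yT => cE; rewrite inE -cE cL andbF.
move=> x y; rewrite in_set2 in_setD1 => /orP[] /eqP-> /andP[yp yT].
  exact: key.
by apply: key => //; rewrite -pab.
Qed.

Lemma card_children_top v : v \in top -> #|children r p v| <= 1.
Proof.
move=> vT; apply/card_le1P => a ac b.
rewrite [RHS]inE; apply/idP/eqP => [bc|-> //].
have := child_nontop (top_low vT) ac; have := child_nontop (top_low vT) bc.
move=> bLT aLT; apply: par_inj => //.
by move: ac bc; rewrite !inE => /andP[_ /eqP->] /andP[_ /eqP->].
Qed.

Hypothesis lowE : #|low| = 2 * alpha G d.

(** Both [top] and its complement in [low] have alpha vertices, so the injection [p] from the latter
    to the former is onto. *)
Lemma card_children_top1 v : v \in top -> #|children r p v| = 1.
Proof.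
move=> vT; apply/eqP; rewrite eqn_leq card_children_top //=.
have pT : p @: (low :\: top) \subset top.
  apply/subsetP => _ /imsetP[w /setDP[wL wT] ->]; apply: par_low_top => //.
  by move: wT; rewrite inE wL /= negbK.
have : p @: (low :\: top) = top.
  apply/eqP; rewrite eqEcard pT (card_in_imset par_inj) cardsD.
  rewrite (setIidPr _) ?lowE; last by apply/subsetP => x /top_low.
  by have [-> _ _] := top_extremal; lia.
move/setP/(_ v); rewrite vT => /imsetP[w /setDP[wL _] vE].
by apply/card_gt0P; exists w; rewrite inE low_root //= vE.
Qed.

Lemma extremal_bristled_matched : 1 < d -> bristled d G.
Proof.
move=> d1.
have low1 x : leaf x -> x \in low by rewrite inE => /eqP->; lia.
have deg_top x : x \in top -> deg x = 2.
  by move=> xT; rewrite (deg_rooting rt) card_children_top1 // low_root // top_low.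
(* T[L] is now a perfect matching along parent edges; the upper ends have degree 2, so the leaves
   are the lower ends. *)
have leafE x : leaf x = (x \in low) && (x \notin top).
  apply/idP/andP => [xl|[xL xT]]; last by rewrite /leaf deg_low_nontop.
  split; first exact: low1.
  by apply: contraTN xl => /deg_top; rewrite /leaf => ->.
have leafnb x : leaf_neighbours x = if x \in top then children r p x else set0.
  apply/setP => y; rewrite inE leafE.
  case: ifPn => xT.
    rewrite (rooting_neighbours rt) (low_root (top_low xT)) !in_setU in_set1.
    have [yc|_] /= := boolP (y \in children r p x).
      by rewrite orbT /=; have := child_nontop (top_low xT) yc; rewrite in_setD andbC.
    apply/negP => /andP[/orP[/eqP->|//] /andP[]].
    by move: xT; rewrite inE => /andP[_ /negbTE->].
  rewrite [RHS]inE; apply/negP => /and3P[xy yL yT].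
  have pyL : p y \in low by move: yT; rewrite inE yL /= negbK.
  have pyT := par_low_top yL pyL.
  have [_ adjE] := rt; move: xy; rewrite inE adjE => /orP[] /andP[xr /eqP E].
    have [xL|xH] := boolP (x \in low); last by have := par_high xH xr; rewrite -E yL.
    by have := par_low_top xL; rewrite -E (negbTE yT) => /(_ yL).
  by rewrite E pyT in xT.
split=> x.
  rewrite leafnb; case: ifP => [xT _|]; last by rewrite eqxx.
  by rewrite deg_top // card_children_top1.
rewrite leafE leafnb negb_and negbK => /orP[/deg_high //|xT].
by rewrite xT => c0; have := card_children_top1 xT; rewrite c0 cards0.
Qed.

End Extremal.

Lemma deg_gt0 (G : sgraph) : connected G -> 1 < #|G| -> forall x : G, 0 < deg x.
Proof.
move=> cG n1 x; rewrite lt0n; apply/eqP => /eqP; rewrite cards_eq0 => /eqP N0.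
suff : #|G| <= #|[set x]| by rewrite cards1; lia.
apply: (connected_card_le cG (set11 x)) => u v /set1P-> xv.
have : v \in set0 by rewrite -N0 inE.
by rewrite in_set0.
Qed.

(* For d = 1 the extremal trees are the paths, whose low vertices are just the two leaves. *)
Lemma bristled1 (G : sgraph) : connected G -> 5 <= #|G| ->
  (forall x : G, 1 < deg x -> deg x = 2) -> bristled 1 G.
Proof.
move=> cG n5 deg2; have d0 := deg_gt0 cG (leq_trans (isT : 1 < 5) n5).
have nl (x : G) : ~~ leaf x -> deg x = 2.
  by move=> xl; apply: deg2; move: (d0 x) xl; rewrite /leaf; lia.
split=> x; last by move=> /nl.
move=> nx0; have sub : leaf_neighbours x \subset neighbours x.
  by apply/subsetP => y; rewrite inE => /andP[].
(* If all neighbours of [x] were leaves, [x] and its neighbours would be the whole graph, which has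
   then at most 3 vertices. *)
have neq : leaf_neighbours x != neighbours x.
  apply/eqP => eqN.
  have : #|G| <= #|x |: neighbours x|.
    apply: (connected_card_le cG (setU11 x _)) => u v /setU1P[->|].
      by move=> xv; rewrite !inE xv orbT.
    by rewrite -eqN => ux uv; rewrite (leaf_neighbour_unique ux uv) setU11.
  rewrite cardsU1 -/(deg x) inE adj_irrefl.
  by case: (boolP (leaf x)) => [/eqP->|/nl->]; lia.
have lt := proper_card (introT properP (conj sub _)).
have ltN : #|leaf_neighbours x| < deg x.
  by apply: proper_card; rewrite properEneq neq.
move: nx0; rewrite -card_gt0 => nx0.
have xnl : ~~ leaf x by rewrite /leaf; lia.
by have := nl x xnl; lia.
Qed.

Lemma extremal_bristled e (G : sgraph) : tree G -> 5 <= #|G| ->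
  (2 * e).+1 * alpha G e.+1 = e * #|G| + 2 -> bristled e.+1 G.
Proof.
move=> tG n5 aE; have [cG _] := tG.
have [r0 _] : exists x : G, true by case: cG => /card_gt0P[x _] _; exists x.
(* If all degrees are at most d, then n <= 2 alpha, and the extremal equation forces alpha <= 2, so
   n <= 4. *)
have [/forallP high|] := boolP [forall x : G, x \in low G e.+1].
  have lowT : low G e.+1 = setT by apply/setP => x; rewrite high inE.
  have [p [dep rt]] := tree_rooting r0 tG.
  have := card_low_leq e.+1 rt; rewrite lowT cardsT => half.
  have : e * #|G| <= e * (2 * alpha G e.+1) by rewrite leq_mul2l half orbT.
  by lia.
rewrite negb_forall => /existsP[r rH].
have [p [dep rt]] := tree_rooting r tG.
have half := card_low_leq e.+1 rt.
have topE := card_top_eq rt rH; have hl := card_high_links p rH.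
have sd := sum_deg_high G e.+1; have ta := top_alpha rt rH.
have nE := cardsC (low G e.+1).
have ehalf : e * #|low G e.+1| <= e * (2 * alpha G e.+1) by rewrite leq_mul2l half orbT.
(* Put n = h + |L| in the equation: |L| <= 2 alpha yields alpha <= eh + 2, and the count of [top]
   yields the converse. *)
have alphaE : alpha G e.+1 = e * #|~: low G e.+1| + 2.
  move: aE; rewrite -nE; move: (\sum_(_ in _) _) topE sd => s topE.
  by rewrite -addn2 mulnDl; lia.
(* This comes from cancelling a factor e, hence the separate treatment of d = 1 below. *)
have lowE : 0 < e -> #|low G e.+1| = 2 * alpha G e.+1.
  move=> e0; apply/eqP; rewrite -(eqn_pmul2l e0).
  by move: aE; rewrite -nE mulnDr => aE; apply/eqP; lia.
case: e {ehalf} rH half topE hl sd ta nE alphaE lowE aE => [|e].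
  move=> rH _ _ _ _ _ _ alphaE _ _; apply: bristled1 => // x xd.
  by apply: (deg_high rt rH) => //; rewrite inE -ltnNge.
move=> rH _ _ _ _ _ _ alphaE lowE _.
exact: (extremal_bristled_matched rt rH _ alphaE (lowE isT)).
Qed.

Lemma card_sum (I : finType) (A : {set I}) : #|A| = \sum_i (i \in A).
Proof. by rewrite -sum1_card big_mkcond; apply: eq_bigr => i _; case: (i \in A). Qed.

(** * Counting and independent sets in bristled trees *)

Section Bristled.
Variables (d : nat) (G : sgraph).
Hypothesis bG : bristled d G.

Let bristled_pendant (x : G) : leaf_neighbours x != set0 ->
  deg x = 2 /\ #|leaf_neighbours x| = 1.
Proof. by case: bG => h _; apply: h. Qed.

Let bristled_core (x : G) : ~~ leaf x -> leaf_neighbours x = set0 -> deg x = d.+1.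
Proof. by case: bG => _; apply. Qed.

(** These are the support vertices. In a bristled graph, leaves, [pendant] and [core] partition the
    vertices. *)
Definition pendant : {set G} := [set x | leaf_neighbours x != set0].
Definition core : {set G} := [set x | ~~ leaf x & leaf_neighbours x == set0].

Lemma pendantP x y : adj x y -> leaf y -> x \in pendant.
Proof. by move=> xy yl; rewrite inE; apply/set0Pn; exists y; rewrite !inE xy. Qed.

Lemma pendant_nonleaf x : x \in pendant -> ~~ leaf x.
Proof. by rewrite inE /leaf => /bristled_pendant[-> _]. Qed.

(** Double counting: each leaf is seen from exactly one vertex. *)
Lemma sum_leaf_neighbours : \sum_(x : G) #|leaf_neighbours x| = #|[set y : G | leaf y]|.
Proof.
under eq_bigr do rewrite card_sum.
rewrite exchange_big card_sum; apply: eq_bigr => y _ /=.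
rewrite inE; have [yl|/negbTE yl] := boolP (leaf y); last first.
  by rewrite big1 // => x _; rewrite inE yl andbF.
rewrite -[RHS](eqP yl) /deg card_sum; apply: eq_bigr => x _.
by rewrite !inE yl andbT adj_sym.
Qed.

Lemma card_leaves : #|[set y : G | leaf y]| = #|pendant|.
Proof.
rewrite -sum_leaf_neighbours card_sum; apply: eq_bigr => x _; rewrite inE.
by have [->|/bristled_pendant[]//] := eqVneq (leaf_neighbours x) set0; rewrite cards0.
Qed.

Lemma card_bristled : #|G| = 2 * #|pendant| + #|core|.
Proof.
rewrite mul2n -addnn -{1}card_leaves -cardsT !card_sum -!big_split.
apply: eq_bigr => x _; rewrite !inE /=.
have := @pendant_nonleaf x; rewrite inE.
by case: (leaf x); case: (leaf_neighbours x == set0) => //= /(_ isT).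
Qed.

Lemma sum_deg_bristled :
  \sum_(x : G) deg x = 3 * #|pendant| + d.+1 * #|core|.
Proof.
have -> : 3 * #|pendant| = #|[set y : G | leaf y]| + 2 * #|pendant|.
  by rewrite card_leaves mulSn.
rewrite !card_sum !big_distrr -!big_split; apply: eq_bigr => x _ /=.
have := @pendant_nonleaf x; rewrite !inE.
have [xN|xN] := eqVneq (leaf_neighbours x) set0 => /=.
  have [/eqP-> _|xl _] := boolP (leaf x); first by rewrite !muln0.
  by rewrite bristled_core // muln1.
by move=> /(_ isT)/negbTE->; have [-> _] := bristled_pendant xN; rewrite muln0.
Qed.

Hypotheses (d_gt0 : 0 < d) (tG : tree G).

(** Handshake with P pendant and C core vertices: 3P + (d+1)C + 2 = 2(2P + C). *)
Lemma card_pendant : #|pendant| = d.-1 * #|core| + 2.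
Proof.
have := sum_deg_tree tG; rewrite sum_deg_bristled card_bristled.
have -> : d.+1 * #|core| = d.-1 * #|core| + 2 * #|core|.
  by rewrite -mulnDl; congr (_ * _); lia.
by move: (d.-1 * _) => q; lia.
Qed.

(** The leaves attain the bound. Conversely, core vertices have too large a degree, so an admissible
    set meets only pendant edges, each at most once. *)
Lemma alpha_bristled : alpha G d = #|pendant|.
Proof.
apply/eqP; rewrite eqn_leq; apply/andP; split; last first.
  rewrite -card_leaves; apply: leq_alpha => [x y|x]; rewrite !inE; last by move/eqP->.
  by move=> xl yl; apply/negP => /pendantP/(_ yl)/pendant_nonleaf; rewrite xl.
apply: alpha_leq => S Si Sd.
have SP x : x \in S -> ~~ leaf x -> x \in pendant.
  move=> xS xl; rewrite inE; apply/eqP => /(bristled_core xl) xd.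
  by have := Sd x xS; rewrite xd ltnn.
(* [f] names a pendant edge by its pendant end; the default is never reached, as a leaf has a
   neighbour. *)
pose f (x : G) := if leaf x then odflt x [pick y | adj x y] else x.
have fleaf x : leaf x -> adj x (f x).
  move=> xl; rewrite /f xl; case: pickP => // none.
  by move: xl; rewrite /leaf /deg (_ : neighbours x = set0) ?cards0 //;
     apply/setP => y; rewrite !inE none.
have fnonleaf x : ~~ leaf x -> f x = x by rewrite /f => /negbTE->.
have fP x : x \in S -> f x \in pendant.
  move=> xS; have [xl|xl] := boolP (leaf x); last by rewrite fnonleaf ?SP.
  by apply: (@pendantP _ x) => //; rewrite adj_sym fleaf.
have finj : {in S &, injective f}.
  move=> x y xS yS fxy; have [xl|xl] := boolP (leaf x); have [yl|yl] := boolP (leaf y).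
  - have := fP x xS; rewrite inE => /bristled_pendant[_ /eqP/cards1P[z zE]].
    have : x \in leaf_neighbours (f x) by rewrite !inE adj_sym fleaf.
    have : y \in leaf_neighbours (f x) by rewrite fxy !inE adj_sym fleaf.
    by rewrite zE => /set1P-> /set1P->.
  - by have := Si x y xS yS; rewrite -(fnonleaf y yl) -fxy fleaf.
  - by have := Si y x yS xS; rewrite -(fnonleaf x xl) fxy fleaf.
  - by rewrite -(fnonleaf x xl) fxy fnonleaf.
rewrite -(card_in_imset finj); apply: subset_leq_card.
by apply/subsetP => _ /imsetP[x xS ->]; apply: fP.
Qed.

Lemma bristled_alpha_eq : (2 * d.-1).+1 * alpha G d = d.-1 * #|G| + 2.
Proof. rewrite alpha_bristled card_bristled card_pendant; ring. Qed.

Hypothesis n5 : 5 <= #|G|.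

(** Without core vertices there are two pendant vertices and two leaves, so n = 4. *)
Lemma core_neq0 : core != set0.
Proof.
apply: contraTneq n5 => c0.
by rewrite card_bristled card_pendant c0 cards0 muln0.
Qed.

(* Two adjacent pendant vertices and their leaves would form a P4 component. *)
Lemma pendant_adj x y : x \in pendant -> y \in pendant -> ~~ adj x y.
Proof.
move=> xP yP; apply/negP => xy.
have [/set0Pn[c cC]] := core_neq0.
pose A := [set x; y] :|: leaf_neighbours x :|: leaf_neighbours y.
(* A pendant vertex has degree 2 and one leaf, so [v] and that leaf exhaust the neighbours of
   [u]. *)
have inA u v : u \in pendant -> v \in pendant -> adj u v ->
    forall z, adj u z -> z \in v |: leaf_neighbours u.
  move=> uP vP uv z uz; have := uP; rewrite inE => /bristled_pendant[du /eqP lu].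
  have sub : v |: leaf_neighbours u \subset neighbours u.
    apply/subsetP => w; rewrite in_setU1 => /orP[/eqP->|]; first by rewrite inE.
    by rewrite inE => /andP[].
  have /eqP-> : v |: leaf_neighbours u == neighbours u; last by rewrite inE.
  rewrite eqEcard sub cardsU1 (eqP lu) -/(deg u) du.
  by rewrite inE (negbTE (pendant_nonleaf vP)) andbF.
have : c \in A.
  have [cG _] := tG; apply: (connected_closed (a := x) cG).
    by rewrite !inE eqxx.
  move=> u v; rewrite !in_setU !in_set1 -!orbA => /or4P[/eqP->|/eqP->|ux|uy] uv.
  - by have := inA x y xP yP xy v uv; rewrite in_setU1 => /orP[] ->; rewrite ?orbT.
  - have := inA y x yP xP _ v uv; rewrite adj_sym in_setU1 => /(_ xy)/orP[] ->; rewrite ?orbT //.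
  - by rewrite (leaf_neighbour_unique ux uv) eqxx.
  - by rewrite (leaf_neighbour_unique uy uv) eqxx orbT.
move: cC; rewrite inE => /andP[cl /eqP cN].
rewrite !in_setU !in_set1 -!orbA => /or4P[/eqP cx|/eqP cy||].
- by move: xP; rewrite inE -cx cN eqxx.
- by move: yP; rewrite inE -cy cN eqxx.
- by rewrite inE (negbTE cl) andbF.
- by rewrite inE (negbTE cl) andbF.
Qed.

End Bristled.

(** * Induced subgraphs and deletion of leaves *)

Section Induced.
Variables (G : sgraph) (P : pred G).

Definition induced_adj (x y : {x : G | P x}) := adj (val x) (val y).

Lemma induced_adj_sym : symmetric induced_adj.
Proof. by move=> x y; apply: adj_sym. Qed.

Lemma induced_adj_irrefl : irreflexive induced_adj.
Proof. by move=> x; apply: adj_irrefl. Qed.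

Definition induced : sgraph := SGraph induced_adj_sym induced_adj_irrefl.

Lemma deg_induced (x : induced) : deg x = #|[set y in neighbours (val x) | P y]|.
Proof.
rewrite /deg -(card_imset _ (@val_inj _ _ {x : G | P x})); apply: eq_card => y.
rewrite !inE; apply/imsetP/andP => [[z + ->]|[xy Py]].
  by rewrite inE => xz; split=> //; apply: valP.
by exists (Sub y Py); rewrite ?SubK // inE /= /induced_adj SubK.
Qed.

Lemma acyclic_induced : acyclic G -> acyclic induced.
Proof.
move=> aG c /andP[cyc un]; rewrite -(size_map val); apply: aG; apply/andP; split.
  by case: c cyc {un} => //= x c; rewrite -map_rcons path_map.
by rewrite map_inj_uniq //; apply: val_inj.
Qed.

End Induced.

(** Rooted at a non-leaf, the tree has no leaf as a parent, so the climb to the root survives the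
    deletion. *)
Lemma tree_induced_nonleaf (G : sgraph) (r : G) : tree G -> ~~ leaf r ->
  tree (induced [pred x : G | ~~ leaf x]).
Proof.
move=> tG rl; have [_ aG] := tG; split; last exact: acyclic_induced.
set H := induced _; have [p [dep rt]] := tree_rooting r tG.
have [depS adjE] := rt.
have p_nonleaf x : x != r -> ~~ leaf (p x).
  move=> xr; have [->//|pr] := eqVneq (p x) r.
  rewrite /leaf (deg_rooting rt) pr addn1 eqSS cards_eq0.
  by apply/set0Pn; exists x; rewrite !inE xr eqxx.
have to_root n : forall x : H, dep (val x) < n ->
    connect (@adj H) x (Sub r rl : {x : G | ~~ leaf x}).
  elim: n => // n IHn x xn; have [xr|xr] := eqVneq (val x) r.
    by rewrite (_ : x = Sub r rl) //; apply: val_inj; rewrite SubK.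
  pose y : H := Sub (p (val x)) (p_nonleaf _ xr).
  apply: (@connect_trans _ _ y).
    by apply: connect1; rewrite /= /induced_adj SubK (rooting_par rt).
  by apply: IHn; rewrite SubK -ltnS -(depS _ xr).
split; first by apply/card_gt0P; exists (Sub r rl : {x : G | ~~ leaf x}).
move=> x y; apply: connect_trans (to_root _ x (ltnSn _)) _.
by rewrite (sym_connect_sym (@adj_sym H)); apply: to_root (ltnSn _).
Qed.

Lemma leaf_edgesP (G : sgraph) (E : {set G}) :
  reflect (exists x y, [/\ adj x y, leaf x & E = [set x; y]]) (E \in leaf_edges G).
Proof.
apply: (iffP idP) => [|[x [y [xy xl ->]]]].
  rewrite !inE => /andP[/existsP[x /existsP[y /andP[xy /eqP->]]] /exists_inP[z]].
  rewrite !inE => /orP[] /eqP-> zl; first by exists x, y.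
  by exists y, x; rewrite adj_sym setUC.
rewrite !inE; apply/andP; split; last by apply/exists_inP; exists x; rewrite ?set21.
by apply/existsP; exists x; apply/existsP; exists y; rewrite xy eqxx.
Qed.

Lemma leaf_edgeE (G : sgraph) (x y : G) :
  adj x y -> ([set x; y] \in leaf_edges G) = leaf x || leaf y.
Proof.
move=> xy; apply/leaf_edgesP/orP => [[u [v [uv ul E]]]|[xl|yl]].
- have : u \in [set x; y] by rewrite E set21.
  by rewrite !inE => /orP[] /eqP<-; [left|right].
- by exists x, y.
- by exists y, x; rewrite adj_sym setUC.
Qed.

Lemma adj_inl_inl (G : sgraph) (F : {set {set G}}) (x y : G) :
  @adj (subdivision F) (inl x) (inl y) = adj x y && ([set x; y] \notin F).
Proof. by []. Qed.

Lemma adj_inl_inr (G : sgraph) (F : {set {set G}}) (x : G) (E : {E : {set G} | E \in F}) :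
  @adj (subdivision F) (inl x) (inr E) = (x \in val E).
Proof. by []. Qed.

(** * A bristled tree is the subdivision of its trimmed tree *)

Section Unsubdivision.
Variables (d : nat) (G : sgraph).
Hypotheses (d_gt0 : 0 < d) (tG : tree G) (n5 : 5 <= #|G|) (bG : bristled d G).

Local Notation H := (induced [pred x : G | ~~ leaf x]).

Let nonleafP (x : H) : ~~ leaf (val x). Proof. exact: (valP x). Qed.

Lemma deg_trim (x : H) : deg x + #|leaf_neighbours (val x)| = deg (val x).
Proof.
rewrite deg_induced addnC [RHS]/deg -[RHS](cardsID [set y : G | leaf y]).
by congr (_ + _); apply: eq_card => y; rewrite !inE // andbC.
Qed.

Lemma deg_trim_pendant (x : H) : val x \in pendant G -> deg x = 1.
Proof.
rewrite inE; case: bG => h _ /h[dx lx].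
by have := deg_trim x; rewrite dx lx; lia.
Qed.

Lemma deg_trim_core (x : H) : val x \notin pendant G -> deg x = d.+1.
Proof.
rewrite inE negbK => /eqP xN; have := deg_trim x.
by rewrite xN cards0 addn0 => ->; case: bG => _; apply.
Qed.

Lemma leaf_trim (x : H) : leaf x = (val x \in pendant G).
Proof.
apply/idP/idP => [|xP]; last by rewrite /leaf deg_trim_pendant.
by apply: contraLR => /deg_trim_core; rewrite /leaf => ->; rewrite eqSS -lt0n.
Qed.

Lemma regular_trim : regular_tree H d.+1.
Proof.
have [/set0Pn[c]] := core_neq0 bG d_gt0 tG n5; rewrite inE => /andP[cl cN].
split; first exact: (tree_induced_nonleaf (r := c)).
  move=> x; have [xP|xP] := boolP (val x \in pendant G).
    by left; apply: deg_trim_pendant.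
  by right; apply: deg_trim_core.
exists (Sub c cl : {x : G | ~~ leaf x}); apply: deg_trim_core.
by rewrite SubK inE cN.
Qed.

Local Notation S := (subdivision (leaf_edges H)).

(* A leaf u of H is sent to the leaf of G hanging at u, and the vertex
   subdividing the leaf-edge at u is sent to u. *)
Definition unsubdivide (c : G) (s : S) : G :=
  match s with
  | inl u => odflt (val u) [pick y in leaf_neighbours (val u)]
  | inr E => odflt c (omap val [pick u in val E | leaf u])
  end.

(** The three kinds of vertices of the subdivision correspond to the leaves, the core and the
    pendant vertices of G, in this order. *)
Variant unsubdivide_spec (c : G) : S -> G -> Prop :=
| UnsubPendant (u : H) y of val u \in pendant G & y \in leaf_neighbours (val u) :
    unsubdivide_spec c (inl u) y
| UnsubCore (u : H) of val u \notin pendant G : unsubdivide_spec c (inl u) (val u)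
| UnsubEdge (E : {E : {set H} | E \in leaf_edges H}) (u w : H) of
    adj u w & val u \in pendant G & val w \notin pendant G & val E = [set u; w] :
    unsubdivide_spec c (inr E) (val u).

Lemma unsubdivideP c s : unsubdivide_spec c s (unsubdivide c s).
Proof.
case: s => [u|E] /=.
  case: pickP => [y yN|N0] /=.
    by apply: UnsubPendant => //; rewrite inE; apply/set0Pn; exists y.
  by apply: UnsubCore; rewrite inE negbK; apply/eqP/setP => y; rewrite N0 inE.
have /leaf_edgesP[u [w [uw ul EE]]] := valP E.
(* Pendant vertices are never adjacent, so a leaf-edge of H has a single leaf end and the choice of
   [u] is forced. *)
have wl : ~~ leaf w.
  apply: contraL uw; rewrite leaf_trim => wP.
  by apply: (pendant_adj bG d_gt0 tG n5) => //; rewrite -leaf_trim.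
case: pickP => [v|/(_ u)] /=; last by rewrite EE set21 ul.
rewrite EE in_set2 => /andP[/orP[] /eqP-> vl]; last by rewrite vl in wl.
by apply: (UnsubEdge _ uw); rewrite -?leaf_trim.
Qed.

Lemma unsubdivide_adj c s t : adj (unsubdivide c s) (unsubdivide c t) = adj s t.
Proof.
have leaf_pendant y u (v : G) : y \in leaf_neighbours u -> v != u -> adj y v = false.
  move=> yu vu; apply: contraNF vu => yv.
  by rewrite (leaf_neighbour_unique yu yv).
have leaf_leaf y u (v : G) : u \in pendant G -> y \in leaf_neighbours u -> leaf v ->
    adj y v = false.
  move=> uP yu vl; apply: (leaf_pendant _ _ _ yu); apply: contraTneq vl => ->.
  exact: pendant_nonleaf bG _ uP.
have isleaf y (u : G) : y \in leaf_neighbours u -> leaf y by rewrite inE => /andP[].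
have core_adj (u v : H) : @adj S (inl u) (inl v) =
    [&& adj u v, val u \notin pendant G & val v \notin pendant G].
  rewrite adj_inl_inl.
  by case: (boolP (adj u v)) => [uv|//]; rewrite !andTb leaf_edgeE // !leaf_trim negb_or.
have edge_adj (u v w : H) : adj v w -> val v \in pendant G -> val w \notin pendant G ->
    val u \notin pendant G -> adj (val u) (val v) = (u \in [set v; w]).
  move=> vw vP wP uP; rewrite in_set2 (negbTE (_ : u != v)); last first.
    by apply: contraNneq uP => ->.
  apply/idP/eqP => [uv|->]; last by rewrite adj_sym.
  by apply: (@leaf_unique_neighbour H v); rewrite // ?leaf_trim // adj_sym.
have edge_leaf (u v w : H) y : adj v w -> val v \in pendant G -> val w \notin pendant G ->
    val u \in pendant G -> y \in leaf_neighbours (val u) ->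
    adj y (val v) = (u \in [set v; w]).
  move=> vw vP wP uP yu; rewrite in_set2 (negbTE (_ : u != w)) ?orbF; last first.
    by apply: contraNneq wP => <-.
  have [<-|uv] := eqVneq u v; first by move: yu; rewrite !inE adj_sym => /andP[].
  by apply: (leaf_pendant _ _ _ yu); rewrite eq_sym (inj_eq val_inj).
(* Nine pairs of kinds; the auxiliary facts above cover them up to symmetry. *)
case: unsubdivideP => [u y uP yu|u uP|E u w uw uP wP EE];
case: unsubdivideP => [v z vP zv|v vP|E' v w' vw vP wP' EE'].
- by rewrite core_adj uP /= andbF (leaf_leaf _ _ _ uP yu) // (isleaf _ _ zv).
- rewrite core_adj uP andbF; apply: (leaf_pendant _ _ _ yu).
  by apply: contraNneq vP => ->.
- by rewrite adj_inl_inr EE'; apply: edge_leaf.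
- rewrite core_adj vP !andbF; rewrite adj_sym; apply: (leaf_pendant _ _ _ zv).
  by apply: contraNneq uP => ->.
- by rewrite core_adj uP vP !andbT.
- by rewrite adj_inl_inr EE'; apply: edge_adj.
- by rewrite adj_sym [RHS]adj_sym adj_inl_inr EE; apply: edge_leaf.
- by rewrite adj_sym [RHS]adj_sym adj_inl_inr EE; apply: edge_adj.
- exact/negbTE/(pendant_adj bG d_gt0 tG n5).
Qed.

Lemma unsubdivide_inj c : injective (unsubdivide c).
Proof.
have leaf_pendant y (u : G) : y \in leaf_neighbours u -> leaf y by rewrite inE => /andP[].
move=> s t; case: unsubdivideP => [u y uP yu|u uP|E u w uw uP wP EE];
case: unsubdivideP => [v z vP zv|v vP|E' v w' vw vP wP' EE'] eqg.
- congr inl; apply/val_inj/(leaf_neighbour_unique zv).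
  by move: yu; rewrite eqg !inE adj_sym => /andP[].
- by move: (nonleafP v); rewrite -eqg (leaf_pendant _ _ yu).
- by move: (nonleafP v); rewrite -eqg (leaf_pendant _ _ yu).
- by move: (nonleafP u); rewrite eqg (leaf_pendant _ _ zv).
- by congr inl; apply: val_inj.
- by move: uP; rewrite eqg vP.
- by move: (nonleafP u); rewrite eqg (leaf_pendant _ _ zv).
- by move: vP; rewrite -eqg uP.
- congr inr; apply: val_inj; rewrite EE EE' (val_inj eqg).
  rewrite (val_inj eqg) in uw.
  by rewrite (leaf_unique_neighbour _ uw vw) // leaf_trim.
Qed.

Lemma unsubdivide_surj c x : exists s, unsubdivide c s = x.
Proof.
have [cG _] := tG; have deg0 := deg_gt0 cG (leq_trans (isT : 1 < 5) n5).
have [xl|xl] := boolP (leaf x).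
  have /card_gt0P[u] := deg0 x; rewrite inE adj_sym => ux.
  have uP := pendantP ux xl; pose v : H := Sub u (pendant_nonleaf bG uP).
  exists (inl v) => /=; case: pickP => [y yu|/(_ x)]; last by rewrite !inE ux xl.
  have [h _] := bG; have := uP; rewrite inE => /h[_ /eqP/cards1P[z Nz]].
  have : x \in leaf_neighbours u by rewrite !inE ux.
  by move: yu; rewrite Nz => /set1P-> /set1P->.
pose v : H := Sub x xl; have [xP|xP] := boolP (x \in pendant G); last first.
  exists (inl v) => /=; case: pickP => [y yx|//].
  by move: xP; rewrite inE negbK => /eqP N0; rewrite N0 inE in yx.
have vl : leaf v by rewrite leaf_trim.
have /card_gt0P[w] : 0 < deg v by rewrite (eqP vl).
rewrite inE => vw; have vwE : [set v; w] \in leaf_edges H by rewrite leaf_edgeE ?vl.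
exists (inr (Sub [set v; w] vwE)) => /=.
case: pickP => [u|/(_ v)]; last by rewrite set21 vl.
rewrite in_set2 => /andP[/orP[] /eqP-> //= wl].
have : ~~ adj x (val w) by apply: (pendant_adj bG d_gt0 tG n5); rewrite -?leaf_trim.
by rewrite [adj _ _]vw.
Qed.

Lemma isomorphic_unsubdivide : isomorphic G S.
Proof.
have [[/card_gt0P[c _] _] _] := tG.
have [g gK Kg] : bijective (unsubdivide c).
  apply: inj_card_bij; first exact: unsubdivide_inj.
  rewrite -[leqRHS](card_image (@unsubdivide_inj c)); apply/subset_leq_card/subsetP => x _.
  by have [s <-] := unsubdivide_surj c x; apply: image_f.
exists g; split; first by exists (unsubdivide c).
by move=> x y; rewrite -{2}[x]Kg -{2}[y]Kg unsubdivide_adj.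
Qed.

End Unsubdivision.

(** * Subdivided regular trees are bristled *)

Section SubdivideLeafEdges.
Variables (d : nat) (H : sgraph).
Hypotheses (d_gt0 : 0 < d) (rH : regular_tree H d.+1).

Local Notation F := (leaf_edges H).
Local Notation S := (subdivision F).

(** Two adjacent leaves would make up the whole tree, leaving no vertex of degree d + 1 > 1. *)
Lemma leaf_adj (x y : H) : leaf x -> leaf y -> ~~ adj x y.
Proof.
move=> xl yl; apply/negP => xy; have [[cH _] _ [z dz]] := rH.
have : z \in [set x; y].
  apply: (connected_closed cH (set21 x y)) => u v.
  rewrite !in_set2 => /orP[] /eqP-> uv.
    by rewrite (leaf_unique_neighbour xl uv xy) eqxx orbT.
  by rewrite (leaf_unique_neighbour yl uv (_ : adj y x)) ?eqxx // adj_sym.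
by rewrite in_set2 => /orP[] /eqP zE; [move: xl|move: yl];
  rewrite /leaf -zE dz eqSS; case: d d_gt0.
Qed.

(** Where the edge from [x] towards [y] leads after subdivision; being injective on neighbours, it
    shows that old vertices keep their degree. *)
Definition subdivide_end (x y : H) : S :=
  if insub [set x; y] is Some E then inr E else inl y.

Lemma neighbours_inl (x : H) :
  neighbours (inl x : S) = subdivide_end x @: neighbours x.
Proof.
apply/setP => s; rewrite inE; apply/idP/imsetP => [|[y]].
  case: s => [y /andP[xy nF]|E]; first by exists y; rewrite ?inE // /subdivide_end insubN.
  rewrite adj_inl_inr => xE; have /leaf_edgesP[u [v [uv _ EE]]] := valP E.
  have [y xy Ey] : exists2 y, adj x y & val E = [set x; y].
    move: xE; rewrite EE in_set2 => /orP[] /eqP->; first by exists v.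
    by exists u; rewrite 1?adj_sym // setUC.
  by exists y; rewrite ?inE // /subdivide_end -Ey valK.
rewrite inE => xy ->; rewrite /subdivide_end; case: insubP => [E _ EE|nF].
  by rewrite adj_inl_inr EE set21.
by rewrite adj_inl_inl xy.
Qed.

Lemma subdivide_end_inj (x : H) : {in neighbours x &, injective (subdivide_end x)}.
Proof.
move=> y z; rewrite !inE => xy xz; rewrite /subdivide_end.
case: insubP => [E _ EE|_]; case: insubP => [E' _ EE'|_] //; last by case.
case=> EE''; move: EE'; rewrite -EE'' EE => yz.
have : y \in [set x; z] by rewrite -yz set22.
by rewrite in_set2 => /orP[] /eqP // yx; rewrite yx adj_irrefl in xy.
Qed.

Lemma deg_inl (x : H) : deg (inl x : S) = deg x.
Proof. by rewrite /deg neighbours_inl card_in_imset //; apply: subdivide_end_inj. Qed.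

Lemma leaf_inl (x : H) : leaf (inl x : S) = leaf x.
Proof. by rewrite /leaf deg_inl. Qed.

Lemma neighbours_inr (E : {E : {set H} | E \in F}) :
  neighbours (inr E : S) = inl @: val E.
Proof.
apply/setP => -[y|E']; rewrite inE; last by apply/esym/imsetP => -[].
by rewrite mem_imset //; move=> u v [].
Qed.

Lemma deg_inr E : deg (inr E : S) = 2.
Proof.
rewrite /deg neighbours_inr card_imset => [|u v []//].
have /leaf_edgesP[x [y [xy _ ->]]] := valP E.
by rewrite cards2; case: eqVneq xy => // ->; rewrite adj_irrefl.
Qed.

Lemma leaf_neighbours_inl (x : H) : leaf_neighbours (inl x : S) = set0.
Proof.
apply/setP => -[y|E]; rewrite !inE; last by rewrite /leaf deg_inr andbF.
rewrite leaf_inl adj_inl_inl.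
by have [xy|//] := boolP (adj x y); rewrite leaf_edgeE //; case: (leaf y); rewrite ?orbT ?andbF.
Qed.

(** Exactly one end of a leaf-edge is a leaf, by [leaf_adj], and old vertices keep their degree. *)
Lemma card_leaf_neighbours_inr E : #|leaf_neighbours (inr E : S)| = 1.
Proof.
have /leaf_edgesP[x [y [xy xl EE]]] := valP E.
have yl : ~~ leaf y by apply: contraL xy => yl; apply: leaf_adj.
apply/eqP/cards1P; exists (inl x); apply/setP => s.
rewrite in_set1 [LHS]in_set neighbours_inr; apply/andP/eqP => [[/imsetP[z]]|->]; last first.
  by rewrite leaf_inl mem_imset ?EE ?set21 // => u v [].
by rewrite EE in_set2 => /orP[] /eqP-> -> //; rewrite leaf_inl (negbTE yl).
Qed.

Lemma bristled_subdivision : bristled d S.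
Proof.
split=> [[x|E]|[x|E]].
- by rewrite leaf_neighbours_inl eqxx.
- by rewrite deg_inr card_leaf_neighbours_inr.
- rewrite leaf_inl deg_inl => xl _; have [_ /(_ x)[x1|//] _] := rH.
  by rewrite /leaf x1 in xl.
- by move=> _ E0; have := card_leaf_neighbours_inr E; rewrite E0 cards0.
Qed.

End SubdivideLeafEdges.

(** * Invariance under isomorphism and the equivalence *)

Lemma bristled_isomorphic d (G H : sgraph) :
  isomorphic G H -> bristled d H -> bristled d G.
Proof.
move=> [f [[g fK gK] adjf]] [bP bC]; have finj := can_inj fK.
have neighf x : neighbours (f x) = f @: neighbours x.
  by apply/setP => y; rewrite -(gK y) mem_imset // !inE adjf.
have degf x : deg (f x) = deg x by rewrite /deg neighf card_imset.
have leaff x : leaf (f x) = leaf x by rewrite /leaf degf.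
have lnf x : leaf_neighbours (f x) = f @: leaf_neighbours x.
  by apply/setP => y; rewrite -(gK y) mem_imset // !inE adjf leaff.
split=> x.
  move=> xN; rewrite -degf -(card_imset _ finj) -lnf; apply: bP.
  by rewrite lnf -card_gt0 card_imset // card_gt0.
by move=> xl xN; rewrite -degf; apply: bC; rewrite ?leaff // lnf xN imset0.
Qed.

Theorem theorem7 (d : nat) (T : sgraph) (hd : 0 < d) (hT : tree T)
    (hn : 5 <= #|T|) :
  alpha_extremal d T <->
  exists T' : sgraph,
    regular_tree T' d.+1 /\ isomorphic T (subdivision (leaf_edges T')).
Proof.
case: d hd => // e hd; split=> [/alpha_extremal_nat aE|[T' [rT' isoT]]].
  have bT := extremal_bristled hT hn aE.
  (* The regular tree is T with its leaves deleted. *)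
  by exists (induced [pred x : T | ~~ leaf x]); split;
    [apply: regular_trim|apply: isomorphic_unsubdivide hT hn bT].
apply/alpha_extremal_nat.
exact: bristled_alpha_eq (bristled_isomorphic isoT (bristled_subdivision hd rT')) hd hT.
Qed.
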